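(* In the setting of the context, suppose the regularity assumption and the local worst-case oracle assumption hold, and fix $x\in\mathcal X$ (write $\ell_k(z)=\ell_k(x,z)$). Consider the budget allocation problem $\max\{\frac1N\sum_{i=1}^NV_i(b_i):b\in\mathbb R_+^N,\ \frac1N\sum_{i=1}^Nb_i\le\rho\}$. There exists an optimal dual multiplier $\lambda^\star$ of its budget constraint satisfying $\lambda^\star\in[0,U_\lambda]$, where $$U_\lambda:=\rho^{\frac{1-p}{p}}\,G,\qquad G:=\max_{i\in[N]}G_i,\qquad G_i:=\max_{k\in[K]}\max\{\|\xi\|_*:\xi\in\partial\ell_k(\hat z_i)\}.$$
   Context: Notation: $[n]=\{1,\dots,n\}$; $\mathcal P(\mathcal Z)$ is the set of Borel probability measures on $\mathcal Z$; $\|\cdot\|_*$ is the dual norm of the norm $\|\cdot\|$ below; $\partial\ell_k(\hat z_i)$ is the superdifferential of the concave function $\ell_k$ at $\hat z_i$. An optimal dual multiplier is a minimizer over $\lambda\ge0$ of the Lagrangian dual function $\lambda\mapsto\lambda\rho+\frac1N\sum_{i=1}^N\sup_{b\ge0}\{V_i(b)-\lambda b\}$. Setting. $\mathcal X\subseteq\mathbb R^n$, $\mathcal Z\subseteq\mathbb R^m$. A transportation cost $c:\mathcal Z\times\mathcal Z\to\mathbb R_+$ is lower semicontinuous, satisfies $c(z,z)=0$ for all $z$, and $c(\cdot,\hat z)$ is convex for every fixed $\hat z\in\mathcal Z$. The optimal transport discrepancy is $\mathrm{OT}_c(\mathbb P,\mathbb Q)=\min_{\gamma}\mathbb E_{(z,\hat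 z)\sim\gamma}[c(z,\hat z)]$ over couplings $\gamma$ of $\mathbb P$ and $\mathbb Q$. Given $\hat z_1,\dots,\hat z_N\in\mathcal Z$, let $\hat{\mathbb P}=\frac1N\sum_{i=1}^N\delta_{\hat z_i}$; given $\rho>0$, let $\mathcal P=\{\mathbb P\in\mathcal P(\mathcal Z):\mathrm{OT}_c(\mathbb P,\hat{\mathbb P})\le\rho\}$. Regularity assumption. (i) $\mathcal X$ is nonempty and convex; there exist $\mathbb Q_0\in\mathcal P$ and $x_0\in\mathcal X$ such that $x\mapsto\mathbb E_{z\sim\mathbb Q_0}[\ell(x,z)]$ is inf-compact on $\mathcal X$ (all sublevel sets are compact) and $\mathbb E_{z\sim\mathbb Q_0}[\ell(x_0,z)]>-\infty$; $\mathcal Z$ is nonempty, closed and convex. (ii) $\ell(x,z)=\max_{k\in[K]}\ell_k(x,z)$ with $K\ge2$, where each $\ell_k:\mathbb R^n\times\mathbb R^m\to\mathbb R$ is real-valued, convex in its first and concave in its second argument. (iii) There exist a norm $\|\cdot\|$ on $\mathbb R^m$ and $p\ge1$ with $c(z,\hat z)\ge\|z-\hat z\|^p$ for all $z,\hat z\in\mathcal Z$; moreover, if $p=1$, then for every $x\in\mathcal X$ there exist $g>0$, $\hat z_0\in\mathcal Z$ and $r\in[0,1)$ such that $\ell(x,z)\le g[1+\|z-\hat z_0\|^r]$ for all $z\in\mathcal Z$. Local worst-case oracle assumption. For any $k\in[K]$, $\hat z\in\mathcal Z$, radius $u\ge0$ and accuracy $\epsilon>0$ there is an algorithm that returns $\hat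 v\in\mathbb R^m$ with $\hat z+\hat v\in\mathcal Z$, $c(\hat z+\hat v,\hat z)\le u$, together with $\hat L=\ell_k(\hat z+\hat v)\ge\max\{\ell_k(\hat z+v):v\in\mathbb R^m,\hat z+v\in\mathcal Z,c(\hat z+v,\hat z)\le u\}-\epsilon$. Local utilities. $V_i(b)=\max_{1\le k_1<k_2\le K}V_i^{(k_1,k_2)}(b)$, where $V_i^{(k_1,k_2)}(b)$ is the maximum of $\alpha_1\ell_{k_1}(\hat z_i+v_1)+\alpha_2\ell_{k_2}(\hat z_i+v_2)$ over $\alpha_j,\beta_j\in\mathbb R_+$, $v_j\in\mathbb R^m$ with $\hat z_i+v_j\in\mathcal Z$, $\alpha_jc(\hat z_i+v_j,\hat z_i)\le\beta_j$ ($j=1,2$), $\alpha_1+\alpha_2=1$, $\beta_1+\beta_2=b$. *)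

(* Defs.v *)
From HB Require Import structures.
From mathcomp Require Export all_boot all_order all_algebra.
From mathcomp Require Export all_classical all_reals all_analysis.
Export Order.TTheory GRing.Theory Num.Theory.
Export numFieldNormedType.Exports.

Set Implicit Arguments.
Unset Strict Implicit.
Unset Printing Implicit Defensive.

Local Open Scope classical_set_scope.
Local Open Scope ring_scope.

Definition borel_rV (R : realType) (m : nat) : measurableType _ :=
  g_sigma_algebraType (@open 'rV[R]_m).

Section norms_and_supergradients.
Context {R : realType} {m : nat}.
Implicit Types (u v z xi : 'rV[R]_m) (nrm : 'rV[R]_m -> R).

Record is_norm nrm : Prop := IsNorm {
  norm_eq0 : forall v, nrm v = 0 -> v = 0;
  norm_scale : forall (a : R) v, nrm (a *: v) = `|a| * nrm v;
  norm_triangle : forall u v, nrm (u + v) <= nrm u + nrm v }.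

Definition dotv u v : R := \sum_j u 0 j * v 0 j.

Definition dual_norm nrm xi : R := sup [set dotv xi v | v in [set v | nrm v <= 1]].

Definition superdifferential (f : 'rV[R]_m -> R) z : set 'rV[R]_m :=
  [set xi | forall y, f y <= f z + dotv xi (y - z)].

End norms_and_supergradients.

Section optimal_transport.
Context {R : realType} {m : nat}.
Local Notation T := (borel_rV R m).
Implicit Types (Z : set 'rV[R]_m) (c : 'rV[R]_m -> 'rV[R]_m -> R).

(* A cost on Z x Z is a total function whose values off Z x Z are irrelevant;
   lower semicontinuity is relative to Z x Z. *)
Record transportation_cost Z c : Prop := TransportationCost {
  cost_ge0 : forall z zh, Z z -> Z zh -> 0 <= c z zh;
  cost_lsc : lower_semicontinuous
    (fun w : subspace (Z `*` Z) => (c w.1 w.2)%:E);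
  cost_refl : forall z, Z z -> c z z = 0;
  cost_convex : forall zh, Z zh -> convex_function Z (c ^~ zh) }.

Definition coupling (P Q : set T -> \bar R) : set (probability (T * T)%type R) :=
  [set gamma | (forall A, measurable A -> gamma (A `*` setT) = P A) /\
               (forall B, measurable B -> gamma (setT `*` B) = Q B)].

Definition OT Z c (P Q : set T -> \bar R) : \bar R :=
  ereal_inf [set (\int[gamma]_(w in Z `*` Z) (c w.1 w.2)%:E)%E
            | gamma in coupling P Q].

Definition empirical (N : nat) (zh : 'I_N -> 'rV[R]_m) (A : set T) : \bar R :=
  ((N%:R^-1)%:E * \sum_(i < N) dirac (zh i : T) A)%E.

(* Borel probability measures on the closed set Z are the Borel probability
   measures on R^m that give mass 1 to Z. *)
Definition ambiguity_set Z c (N : nat) (zh : 'I_N -> 'rV[R]_m) (rho : R) :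
    set (probability T R) :=
  [set P | P Z = 1%E /\ (OT Z c P (empirical zh) <= rho%:E)%E].

End optimal_transport.

Section assumptions.
Context {R : realType} {n m K N : nat}.
Implicit Types (X : set 'rV[R]_n) (Z : set 'rV[R]_m).
Implicit Types (c : 'rV[R]_m -> 'rV[R]_m -> R) (zh : 'I_N -> 'rV[R]_m).

(* The maximum of finitely many reals; it is finite as soon as 0 < K. *)
Definition loss (l : 'I_K -> 'rV[R]_n -> 'rV[R]_m -> R)
    (x : 'rV[R]_n) (z : 'rV[R]_m) : \bar R :=
  \big[maxe/-oo%E]_(k < K) (l k x z)%:E.

Definition expected_loss Z l (Q : probability (borel_rV R m) R)
    (x : 'rV[R]_n) : \bar R :=
  (\int[Q]_(z in Z) loss l x z)%E.

Definition inf_compact_on X (f : 'rV[R]_n -> \bar R) : Prop :=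
  forall t : R, compact [set x | X x /\ (f x <= t%:E)%E].

Record regularity X Z c zh (rho : R)
    (l : 'I_K -> 'rV[R]_n -> 'rV[R]_m -> R)
    (nrm : 'rV[R]_m -> R) (p : R) : Prop := Regularity {
  reg_X_nonempty : X !=set0;
  reg_X_convex : convex_set X;
  reg_inf_compact : exists (Q0 : probability (borel_rV R m) R) (x0 : 'rV[R]_n),
    [/\ ambiguity_set Z c zh rho Q0, X x0,
        inf_compact_on X (expected_loss Z l Q0)
      & (-oo < expected_loss Z l Q0 x0)%E];
  reg_Z_nonempty : Z !=set0;
  reg_Z_closed : closed Z;
  reg_Z_convex : convex_set Z;
  reg_K : (2 <= K)%N;
  reg_l_convex : forall k z, convex_function setT (fun x => l k x z);
  reg_l_concave : forall k x, convex_function setT (fun z => - l k x z);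
  reg_norm : is_norm nrm;
  reg_p : 1 <= p;
  reg_growth_cost : forall z z', Z z -> Z z' -> nrm (z - z') `^ p <= c z z';
  reg_growth_loss : p = 1 -> forall x, X x ->
    exists (g : R) (z0 : 'rV[R]_m) (r : R),
      [/\ 0 < g, Z z0, 0 <= r < 1
        & forall z, Z z -> (loss l x z <= (g * (1 + nrm (z - z0) `^ r))%:E)%E] }.

End assumptions.

Section budget_allocation.
Context {R : realType} {m K N : nat}.
Implicit Types (Z : set 'rV[R]_m) (c : 'rV[R]_m -> 'rV[R]_m -> R).
Implicit Types (lk : 'I_K -> 'rV[R]_m -> R) (zh : 'I_N -> 'rV[R]_m).

Definition local_oracle Z c lk : Prop :=
  forall (k : 'I_K) (z : 'rV[R]_m) (u eps : R), Z z -> 0 <= u -> 0 < eps ->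
    exists (vh : 'rV[R]_m) (Lh : R),
      [/\ Z (z + vh), c (z + vh) z <= u, Lh = lk k (z + vh)
        & (ereal_sup [set (lk k (z + v))%:E
                     | v in [set v | Z (z + v) /\ c (z + v) z <= u]%R]
             - eps%:E <= Lh%:E)%E].

Definition local_utility_pair Z c lk (z : 'rV[R]_m) (k1 k2 : 'I_K) (b : R) :
    \bar R :=
  ereal_sup [set y | exists (a1 a2 b1 b2 : R) (v1 v2 : 'rV[R]_m),
    [/\ [/\ 0 <= a1, 0 <= a2, 0 <= b1 & 0 <= b2],
        Z (z + v1) /\ Z (z + v2),
        a1 * c (z + v1) z <= b1 /\ a2 * c (z + v2) z <= b2,
        a1 + a2 = 1 /\ b1 + b2 = b
      & y = (a1 * lk k1 (z + v1) + a2 * lk k2 (z + v2))%:E]].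

Definition local_utility Z c lk (z : 'rV[R]_m) (b : R) : \bar R :=
  \big[maxe/-oo%E]_(k : 'I_K * 'I_K | (k.1 < k.2)%N)
    local_utility_pair Z c lk z k.1 k.2 b.

(* Lagrangian dual function of
   max { 1/N * \sum_i V_i (b_i) : b >= 0, 1/N * \sum_i b_i <= rho }
   with the budget constraint dualized. *)
Definition dual_function Z c lk zh (rho lambda : R) : \bar R :=
  ((lambda * rho)%:E + (N%:R^-1)%:E * \sum_(i < N)
     ereal_sup [set local_utility Z c lk (zh i) b - (lambda * b)%:E
               | b in [set b : R | (0 <= b)%R]])%E.

Definition optimal_dual_multiplier Z c lk zh (rho lambda : R) : Prop :=
  0 <= lambda /\ forall mu : R, 0 <= mu ->
    (dual_function Z c lk zh rho lambda <= dual_function Z c lk zh rho mu)%E.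

(* The superdifferential of a finite concave function on R^m is nonempty and
   compact, so sup is a maximum. *)
Definition local_lipschitz (nrm : 'rV[R]_m -> R) lk (z : 'rV[R]_m) : R :=
  \big[Num.max/0]_(k < K)
    sup [set dual_norm nrm xi | xi in superdifferential (lk k) z].

Definition multiplier_bound (nrm : 'rV[R]_m -> R) (p : R) lk zh (rho : R) : R :=
  rho `^ ((1 - p) / p) * \big[Num.max/0]_(i < N) local_lipschitz nrm lk (zh i).

End budget_allocation.

(* Main.v *)
Require Import Defs.
From mathcomp Require Import finmap ring lra.

Set Implicit Arguments.
Unset Strict Implicit.
Unset Printing Implicit Defensive.

Local Open Scope classical_set_scope.
Local Open Scope ring_scope.

(* Write [W] for the average over [i] of [max_k l_k (zh_i)], [D] for the dual
   function and [U] for the bound.  Taking [b = 0] gives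
   [D lambda >= lambda rho + W].  Conversely, supergradients give
   [l_k (zh_i + v) <= l_k (zh_i) + G |v|], and the tangent line at [rho] of
   [b |-> b^(1/p)] turns this into
   [l_k (zh_i + v) <= l_k (zh_i) + (U / p) c (zh_i + v, zh_i) + (1 - 1/p) U rho],
   whence [D (U / p) <= U rho + W].  So [D (U / p) <= D lambda] for every
   [lambda >= U], and a minimizer of the lower semicontinuous [D] over the
   compact interval [0, U] is a minimizer over the half-line. *)

(** * Bilinearity and a crude bound for the dot product *)

Section dot_product.
Context {R : realType} {m : nat}.
Implicit Types (u v w : 'rV[R]_m) (a : R).

Lemma dotvDl u v w : dotv (u + v) w = dotv u w + dotv v w.
Proof.
by rewrite /dotv -big_split; apply: eq_bigr => j _; rewrite mxE mulrDl.
Qed.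

Lemma dotvDr u v w : dotv u (v + w) = dotv u v + dotv u w.
Proof.
by rewrite /dotv -big_split; apply: eq_bigr => j _; rewrite mxE mulrDr.
Qed.

Lemma dotvZl a u v : dotv (a *: u) v = a * dotv u v.
Proof. by rewrite /dotv mulr_sumr; apply: eq_bigr => j _; rewrite mxE mulrA. Qed.

Lemma dotvZr a u v : dotv u (a *: v) = a * dotv u v.
Proof. by rewrite /dotv mulr_sumr; apply: eq_bigr => j _; rewrite mxE mulrCA. Qed.

Lemma dotv0r u : dotv u 0 = 0.
Proof. by rewrite -(scale0r 0) dotvZr mul0r. Qed.

Lemma dotv_delta u j : dotv u (delta_mx 0 j) = u 0 j.
Proof.
rewrite /dotv (bigD1 j) //= big1 => [|i ij]; rewrite !mxE ?eqxx ?mulr1 ?addr0//.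
by rewrite (negbTE ij) mulr0.
Qed.

Lemma dotv_deltal u j : dotv (delta_mx 0 j) u = u 0 j.
Proof. by rewrite -[RHS]dotv_delta /dotv; apply: eq_bigr => i _; rewrite mulrC. Qed.

Lemma entry_le_normr v j : `|v 0 j| <= `|v|.
Proof.
by rewrite [leRHS]/Num.norm /= mx_normrE; apply/bigmax_geP; right; exists (0, j).
Qed.

Lemma dotv_le u v : dotv u v <= (\sum_j `|u 0 j|) * `|v|.
Proof.
rewrite /dotv mulr_suml; apply: ler_sum => j _.
rewrite (le_trans (ler_norm _))// normrM ler_wpM2l//.
exact: entry_le_normr.
Qed.

End dot_product.

(** * Equivalence of an arbitrary norm with the sup norm *)

Section norms.
Context {R : realType} {m : nat} (nrm : 'rV[R]_m -> R).
Hypothesis hnrm : is_norm nrm.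
Implicit Types (u v : 'rV[R]_m).

Lemma nrm0 : nrm 0 = 0.
Proof. by rewrite -(scale0r 0) (norm_scale hnrm) normr0 mul0r. Qed.

Lemma nrmN v : nrm (- v) = nrm v.
Proof. by rewrite -scaleN1r (norm_scale hnrm) normrN1 mul1r. Qed.

Lemma nrm_ge0 v : 0 <= nrm v.
Proof.
by have := norm_triangle hnrm v (- v); rewrite subrr nrm0 nrmN; lra.
Qed.

Lemma nrm_le v : nrm v <= (\sum_j nrm (delta_mx 0 j)) * `|v|.
Proof.
rewrite {1}(row_sum_delta v) mulr_suml.
elim/big_ind2 : _ => [|x1 x2 y1 y2 h1 h2|j _]; first by rewrite nrm0.
- by rewrite (le_trans (norm_triangle hnrm _ _))// lerD.
- rewrite (norm_scale hnrm) mulrC ler_wpM2l ?nrm_ge0//.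
  exact: entry_le_normr.
Qed.

Lemma nrm_continuous : continuous nrm.
Proof.
move=> v; apply/(@cvgrPdist_le _ _ _ (nbhs v)) => e e0.
set B := \sum_j nrm (delta_mx 0 j).
have B0 : 0 <= B by apply: sumr_ge0 => j _; exact: nrm_ge0.
(* [B] may vanish (when [m = 0]), so the radius is taken to be [e / (B + 1)]. *)
have B1 : 0 < B + 1 by lra.
near=> w.
have vw : `|v - w| <= e / (B + 1).
  by near: w; apply: (@cvgr_dist_le _ _ _ (nbhs v) _ id);
    [exact: cvg_id | rewrite divr_gt0].
have h : nrm (v - w) <= e.
  rewrite (le_trans (nrm_le _))//.
  rewrite (@le_trans _ _ ((B + 1) * `|v - w|)) ?ler_wpM2r ?lerDl//.
  by rewrite mulrC -ler_pdivlMr.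
have h1 := norm_triangle hnrm (v - w) w.
have h2 := norm_triangle hnrm (w - v) v.
rewrite subrK in h1; rewrite subrK -opprB nrmN in h2.
by rewrite ler_norml; apply/andP; split; lra.
Unshelve. all: by end_near. Qed.

(** By compactness the continuous [nrm] attains its minimum on the sup-norm unit sphere. That
    minimum is positive, and [C] is its inverse. *)
Lemma normr_le_nrm : exists2 C : R, 0 <= C & forall v, `|v| <= C * nrm v.
Proof.
pose A := [set v : 'rV[R]_m | `|v| = 1].
have [A0|/set0P/negP] := pselect (A !=set0); last first.
  (* The sphere is empty only when [m = 0]; then every vector is zero and [C = 0] works. *)
  rewrite negbK => /eqP A0; exists 0 => // v; rewrite mul0r normr_le0.
  apply: contraPT (A0) => v0 /seteqP[/(_ (`|v|^-1 *: v)) h _]; apply: h.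
  by rewrite /A /= normrZ normfV normr_id mulVf// normr_eq0.
have cA : compact A.
  apply: bounded_closed_compact.
    by exists 1; split => // y y1 v /= ->; exact: ltW.
  have -> : A = Num.norm @^-1` [set 1] by [].
  by apply: preimage_closed => [? _|]; [exact: norm_continuous | exact: closed_eq].
have [u uA umin] := EVT_min_rV A0 cA
  (continuous_subspaceT nrm_continuous).
have u1 : `|u| = 1 by have := set_mem uA.
have u0 : 0 < nrm u.
  rewrite lt_neqAle nrm_ge0 andbT eq_sym; apply: contra_eq_neq u1.
  by move=> /(norm_eq0 hnrm) ->; rewrite normr0 eq_sym oner_eq0.
exists (nrm u)^-1 => [|v]; first by rewrite invr_ge0 ltW.
have [->|v0] := eqVneq v 0; first by rewrite normr0 nrm0 mulr0.
rewrite mulrC ler_pdivlMr// mulrC -ler_pdivlMr ?normr_gt0//.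
rewrite mulrC -[ `|v|^-1 ]ger0_norm ?invr_ge0// -(norm_scale hnrm).
by apply/umin/mem_set; rewrite /A /= normrZ normfV normr_id mulVf// normr_eq0.
Qed.

End norms.

(** * Dual norms and their boundedness on superdifferentials *)

Section dual_norms.
Context {R : realType} {m : nat} (nrm : 'rV[R]_m -> R).
Hypothesis hnrm : is_norm nrm.
Implicit Types (u v xi : 'rV[R]_m).

(** The unit ball of [nrm] is bounded by equivalence of norms. This makes the [sup] in [dual_norm] a
    true least upper bound, and one [C] serves all [xi], so bounding the coordinates of [xi] bounds
    its dual norm. *)
Lemma dual_norm_bounds : exists2 C : R, 0 <= C & forall xi,
  ubound [set dotv xi v | v in [set v | nrm v <= 1]] (C * \sum_j `|xi 0 j|).
Proof.
have [C C0 hC] := normr_le_nrm hnrm; exists C => // xi _ [v /= v1 <-].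
rewrite mulrC (le_trans (dotv_le _ _))// ler_wpM2l ?sumr_ge0//.
by rewrite (le_trans (hC v))// ler_piMr.
Qed.

Lemma dotv_le_dual_norm xi v : dotv xi v <= dual_norm nrm xi * nrm v.
Proof.
have [v0|v0] := eqVneq (nrm v) 0.
  by rewrite (norm_eq0 hnrm v0) dotv0r nrm0// mulr0.
have v1 : 0 < nrm v by rewrite lt_neqAle eq_sym v0 nrm_ge0.
rewrite -ler_pdivrMr// mulrC -dotvZr; apply: ub_le_sup.
  by have [C _ hC] := dual_norm_bounds; eexists; exact: hC.
by exists ((nrm v)^-1 *: v) => //=; rewrite (norm_scale hnrm) normfV ger0_norm
  ?nrm_ge0// mulVf.
Qed.

(* Probing the supergradient inequality at [z + e_j] and [z - e_j] bounds the
   coordinates of a supergradient. *)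
Lemma superdifferential_bounded (f : 'rV[R]_m -> R) z :
  has_ubound [set dual_norm nrm xi | xi in superdifferential f z].
Proof.
have [C C0 hC] := dual_norm_bounds.
pose B (j : 'I_m) : R := `|f z - f (z - delta_mx 0 j)|
                       + `|f (z + delta_mx 0 j) - f z|.
exists (C * \sum_j B j) => _ [xi /= hxi <-].
rewrite (@le_trans _ _ (C * \sum_j `|xi 0 j|))//.
  apply: ge_sup (hC xi); exists (dotv xi 0), 0 => //=.
  by rewrite nrm0// ler01.
rewrite ler_wpM2l// ler_sum// => j _; rewrite /B.
have zK u : z + u - z = u by rewrite addrC addKr.
have := hxi (z + delta_mx 0 j); have := hxi (z - delta_mx 0 j).
rewrite !zK -scaleN1r dotvZr dotv_delta scaleN1r.
set fm := f (z - _); set fp := f (z + _) => h1 h2.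
have := ler_norm (f z - fm); have := ler_norm (- (fp - f z)).
have := normr_ge0 (f z - fm); have := normr_ge0 (fp - f z).
rewrite normrN => *; rewrite ler_norml; apply/andP; split; lra.
Qed.

End dual_norms.

(** * Existence of supergradients of finite concave functions *)

Section supergradients.
Context {R : realType} {m : nat} (f : 'rV[R]_m -> R).
Hypothesis f_concave : convex_function setT (fun z => - f z).
Implicit Types (z v w xi : 'rV[R]_m).

Lemma concave_le z w (t : R) : 0 <= t -> t <= 1 ->
  t * f z + (1 - t) * f w <= f (t *: z + (1 - t) *: w).
Proof.
move=> t0 t1; have := @f_concave (Itv01 t0 t1) z w.
by move=> /(_ (mem_set I) (mem_set I)); rewrite convRE !mulrN -opprD lerN2.
Qed.

(* One step of the Hahn-Banach extension: slopes to the right of [z] stay below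
   slopes to the left, so a supergradient on a subspace extends to one more
   direction [e]. *)
Lemma supergradient_extend z e xi (L : set 'rV[R]_m) :
  L 0 -> (forall (t : R) v w, L v -> L w -> L (t *: v + (1 - t) *: w)) ->
  (forall v, L v -> f (z + v) <= f z + dotv xi v) ->
  exists s : R, forall (t : R) v, L v ->
    f (z + (v + t *: e)) <= f z + dotv xi v + t * s.
Proof.
move=> L0 Lconv hxi.
(* Every slope to the right is at most every slope to the left, so any number between the two
   families can serve as [s]. *)
have cross (t t' : R) v w : 0 < t -> 0 < t' -> L v -> L w ->
    (f (z + (v + t *: e)) - f z - dotv xi v) / t <=
    (f z + dotv xi w - f (z + (w - t' *: e))) / t'.
  move=> t0 t'0 Lv Lw; rewrite ler_pdivrMr// mulrAC ler_pdivlMr//.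
  have tt' : 0 < t + t' by lra.
  (* This weight gives [a * t = (1 - a) * t'], so [e] cancels in the convex combination and the
     hypothesis on [L] applies. *)
  pose a := t' / (t + t').
  have aE : a * (t + t') = t' by rewrite /a mulfVK// gt_eqF.
  have a0 : 0 <= a by rewrite divr_ge0// ltW.
  have a1 : a <= 1 by rewrite /a ler_pdivrMr//; lra.
  have := concave_le (z + (v + t *: e)) (z + (w - t' *: e)) a0 a1.
  have -> : a *: (z + (v + t *: e)) + (1 - a) *: (z + (w - t' *: e)) =
      z + (a *: v + (1 - a) *: w).
    have {}aE : a * t = (1 - a) * t' by lra.
    apply/rowP => j; rewrite !mxE.
    have := congr1 ( *%R^~ (e 0 j)) aE => /=; lra.
  move=> h; have {h} := le_trans h (hxi _ (Lconv a v w Lv Lw)).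
  rewrite dotvDr !dotvZr; set A := f _; set B := f (_ + (w - _)).
  set C := f z; set p := dotv _ _; set q := dotv _ _ => h.
  have := ler_wpM2r (ltW tt') h.
  have E (x y : R) : (a * x + (1 - a) * y) * (t + t') = t' * x + t * y.
    transitivity (a * (t + t') * x + (t + t' - a * (t + t')) * y); first by ring.
    by rewrite aE; ring.
  by rewrite (mulrDl C) !E; lra.
(* [S] collects the slopes to the right; [cross] with the left slope at [w = 0], [t' = 1] bounds it
   above. *)
pose S := [set (f (z + (tv.2 + tv.1 *: e)) - f z - dotv xi tv.2) / tv.1 |
  tv in [set tv : R * 'rV[R]_m | 0 < tv.1 /\ L tv.2]].
have S0 : S !=set0 by eexists; exists (1, 0).
have Sub : has_ubound S.
  eexists => _ [[t v] /= [t0 Lv] <-]; exact: (cross _ 1 _ 0).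
exists (sup S) => t v Lv; have [t0|t0|->] := ltgtP t 0.
- have : sup S <= (f z + dotv xi v - f (z + (v - (- t) *: e))) / (- t).
    apply: ge_sup => // _ [[t1 v1] /= [t10 Lv1] <-].
    by apply: cross => //; rewrite oppr_gt0.
  by rewrite ler_pdivlMr ?oppr_gt0// scaleNr opprK; lra.
- have : (f (z + (v + t *: e)) - f z - dotv xi v) / t <= sup S.
    by apply: ub_le_sup => //; exists (t, v).
  by rewrite ler_pdivrMr//; lra.
- by rewrite scale0r mul0r !addr0; exact: hxi.
Qed.

(** Induction on [k] builds a supergradient along the vectors supported on the first [k]
    coordinates, adding one basis direction at a time; for [k = m] these are all vectors. *)
Lemma superdifferential_nonempty z : superdifferential f z !=set0.
Proof.
pose L k := [set v : 'rV[R]_m | forall i : 'I_m, (k <= i)%N -> v 0 i = 0].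
have H k : (k <= m)%N ->
    exists xi, forall v, L k v -> f (z + v) <= f z + dotv xi v.
  elim: k => [_|k IH km].
    exists 0 => v Lv; have -> : v = 0 by apply/rowP => j; rewrite mxE; exact: Lv.
    by rewrite dotv0r !addr0.
  have [xi hxi] := IH (ltnW km).
  pose j := Ordinal km; pose e : 'rV[R]_m := delta_mx 0 j.
  have L0 : L k 0 by move=> i _; rewrite mxE.
  have Lconv (t : R) v w : L k v -> L k w -> L k (t *: v + (1 - t) *: w).
    by move=> Lv Lw i ki; rewrite !mxE Lv// Lw// !mulr0 addr0.
  have [s hs] := supergradient_extend e L0 Lconv hxi.
  (* The correction replaces the [j]-th coordinate of [xi] by [s] and leaves the others alone. *)
  exists (xi + (s - xi 0 j) *: e) => v Lv.
  have vE : v = (v - v 0 j *: e) + v 0 j *: e by rewrite subrK.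
  have Lw : L k (v - v 0 j *: e).
    move=> i ki; rewrite !mxE eqxx /=; have [->|ij] := eqVneq i j.
      by rewrite mulr1 subrr.
    rewrite mulr0 subr0; apply: Lv; rewrite ltn_neqAle ki andbT.
    by apply: contra ij => /eqP kE; apply/eqP/val_inj.
  rewrite {1}vE; apply: le_trans (hs _ _ Lw) _.
  rewrite dotvDl dotvZl dotv_deltal.
  rewrite -scaleN1r scalerA dotvDr dotvZr dotv_delta; lra.
have [xi hxi] := H m (leqnn m); exists xi => y.
have := hxi (y - z); rewrite [z + _]addrC subrK; apply => i.
by rewrite leqNgt ltn_ord.
Qed.

End supergradients.

(** A single supergradient gives the estimate with its own dual norm as constant; boundedness of the
    superdifferential lets the [sup] dominate that constant. *)
Lemma concave_lipschitz (R : realType) (m : nat) (nrm : 'rV[R]_m -> R)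
    (f : 'rV[R]_m -> R) z v :
  is_norm nrm -> convex_function setT (fun z => - f z) ->
  f (z + v) <= f z +
    sup [set dual_norm nrm xi | xi in superdifferential f z] * nrm v.
Proof.
move=> hnrm hf; have [xi hxi] := superdifferential_nonempty hf z.
have := hxi (z + v); rewrite [z + v - z]addrC addKr => /le_trans; apply.
rewrite lerD2l (le_trans (dotv_le_dual_norm hnrm _ _))//.
rewrite ler_wpM2r ?nrm_ge0//; apply: ub_le_sup; last by exists xi.
exact: superdifferential_bounded.
Qed.

(* Tangent line at [rho] of the concave function [b |-> b `^ p^-1], evaluated at
   [b = t `^ p]. *)
Lemma powR_tangent (R : realType) (p rho t : R) : 1 <= p -> 0 < rho -> 0 <= t ->
  t <= rho `^ ((1 - p) / p) * (p^-1 * t `^ p + (1 - p^-1) * rho).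
Proof.
move=> p1 rho0 t0; have p0 : 0 < p by lra.
(* For [p = 1] the conjugate exponent is infinite, and the claim is an equality. *)
have [->|pN1] := eqVneq p 1.
  by rewrite subrr mul0r powRr0 invr1 subrr mul0r addr0 !mul1r powRr1.
have q0 : 0 < 1 - p^-1 by rewrite subr_gt0 invf_lt1// lt_neqAle eq_sym pN1.
pose r := rho `^ p^-1.
have r0 : 0 < r by rewrite powR_gt0.
have rp : r `^ p = rho by rewrite -powRrM mulVf ?gt_eqF// powRr1// ltW.
have E : rho `^ ((1 - p) / p) = r / rho.
  rewrite mulrBl mul1r divff ?gt_eqF// powRB ?powRr1 ?(ltW rho0)//.
  by rewrite (gt_eqF rho0) implybT.
have s0 : 0 <= t / r by rewrite divr_ge0// ltW.
have q'0 : 0 < (1 - p^-1)^-1 by rewrite invr_gt0.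
(* Young's inequality for the product of [t / r] and [1], with exponents [p] and [(1 - p^-1)^-1];
   multiplying by [r] gives the tangent line. *)
have := conjugate_powR s0 ler01 p0 q'0.
rewrite invrK powR1 mul1r mulr1 addrC subrK => /(_ erefl).
rewrite ler_pdivrMr// => /le_trans; apply.
rewrite powRM ?invr_ge0 ?(ltW r0)// -(powR_inv1 (ltW r0)) -powRrM.
rewrite mulN1r powRN rp E le_eqVlt; apply/orP; left; apply/eqP; field.
by rewrite !gt_eqF.
Qed.

(** * Lower semicontinuous extended-real functions and their minima on compact sets *)

Section lower_semicontinuity.
Context {R : realType}.

(** Two finite terms share the slack equally; an infinite term absorbs whatever the other one
    lacks. *)
Lemma lte_add_split (a : R) (x y : \bar R) :
  (-oo < x)%E -> (-oo < y)%E -> (a%:E < x + y)%E ->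
  exists2 b : R, (b%:E < x)%E & ((a - b)%:E < y)%E.
Proof.
case: x => [x| |]//; case: y => [y| |]// _ _.
- by rewrite -EFinD lte_fin => h; exists (x - (x + y - a) / 2);
    rewrite lte_fin; lra.
- by move=> _; exists (x - 1); rewrite ?ltry// lte_fin; lra.
- by move=> _; exists (a - y + 1); rewrite ?ltry// lte_fin; lra.
- by move=> _; exists 0; rewrite ltry.
Qed.

Context {T : topologicalType}.
Implicit Types f g : T -> \bar R.

Lemma lower_semicontinuousD f g :
  (forall x, -oo < f x)%E -> (forall x, -oo < g x)%E ->
  lower_semicontinuous f -> lower_semicontinuous g ->
  lower_semicontinuous (fun x => f x + g x)%E.
Proof.
move=> f0 g0 lf lg x a /(lte_add_split (f0 x) (g0 x))[b bf bg].
have [A Ax hA] := lf _ _ bf; have [B Bx hB] := lg _ _ bg.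
exists (A `&` B); first exact: filterI.
by move=> y [/hA Ay /hB By]; have := lteD Ay By; rewrite -EFinD addrC subrK.
Qed.

Lemma lower_semicontinuous_sum (I : Type) (s : seq I) (F : I -> T -> \bar R) :
  (forall i x, -oo < F i x)%E -> (forall i, lower_semicontinuous (F i)) ->
  lower_semicontinuous (fun x => \sum_(i <- s) F i x)%E.
Proof.
move=> F0 lF; have sN t x : (-oo < \sum_(i <- t) F i x)%E.
  elim/big_ind : _ => [|u v|i _]; rewrite ?ltNyr//.
  by case: u => [u| |]//; case: v => [v| |]// _ _; rewrite -EFinD ltNyr.
elim: s => [|i s IH].
  rewrite (_ : (fun _ => _) = cst 0%E); last first.
    by apply/funext => x; rewrite big_nil.
  by move=> x a a0; exists setT => //; exact: filterT.
rewrite (_ : (fun _ => _) = (fun x => F i x + \sum_(i <- s) F i x)%E); last first.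
  by apply/funext => x; rewrite big_cons.
exact: lower_semicontinuousD.
Qed.

Lemma lower_semicontinuousZ (k : R) f : 0 < k -> lower_semicontinuous f ->
  lower_semicontinuous (fun x => k%:E * f x)%E.
Proof.
move=> k0 lf x a h.
have {}h : ((k^-1 * a)%:E < f x)%E by rewrite EFinM lte_pdivrMl.
have [A Ax hA] := lf _ _ h; exists A => // y /hA.
by rewrite EFinM lte_pdivrMl.
Qed.

Lemma lower_semicontinuous_EFin (f : T -> R) :
  continuous f -> lower_semicontinuous (fun x => (f x)%:E).
Proof.
move=> cf; apply/lower_semicontinuousP => a.
rewrite (_ : [set x | _] = f @^-1` [set y | a < y]); last first.
  by apply/seteqP; split => x /=; rewrite lte_fin.
by apply: open_comp => [x _|]; [exact: cf | exact: open_gt].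
Qed.

Lemma lower_semicontinuous_sup (I : Type) (D : set I) (F : I -> T -> \bar R) :
  (forall i, D i -> lower_semicontinuous (F i)) ->
  lower_semicontinuous (fun x => ereal_sup [set F i x | i in D]).
Proof.
move=> lF x a /ereal_sup_gt[_ [i Di <-] h].
have [A Ax hA] := lF _ Di _ _ h; exists A => // y /hA/lt_le_trans; apply.
by apply: ereal_sup_ubound; exists i.
Qed.

End lower_semicontinuity.

(** The sublevel sets at the levels [f y], [y] in [A], are closed with the finite intersection
    property, and a point common to all of them is a minimizer. *)
Lemma compact_lower_semicontinuous_min (R : realType) (T : ptopologicalType)
    (f : T -> \bar R) (A : set T) : compact A -> A !=set0 ->
  (forall x, -oo < f x)%E -> lower_semicontinuous f ->
  exists2 x, A x & forall y, A y -> (f x <= f y)%E.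
Proof.
rewrite compact_In0 => cA [x0 Ax0] fN /lower_semicontinuousP lf.
pose F y := A `&` [set x | (f x <= f y)%E].
have closedF : closed_fam_of A A F.
  exists (fun y => [set x | (f x <= f y)%E]) => // y _.
  case: (f y) (fN y) => [r _|_|//]; last first.
    by rewrite (_ : [set x | _] = setT)//; apply/seteqP; split => // x _ /=;
      rewrite leey.
  rewrite (_ : [set x | _] = ~` [set x | (r%:E < f x)%E]).
    by apply: open_closedC; exact: lf.
  by apply/seteqP; split => x /=; rewrite leNgt => /negP.
have finF : finI A F.
  move=> D' D'A.
  (* A point of least value among the finitely many chosen ones lies in all their sublevel sets;
     [x0] covers the empty family. *)
  have [y Ay hy] : exists2 y, A y & forall z, z \in D' -> (f y <= f z)%E.
    suff [y Ay hy] : exists2 y, A y &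
        forall z, z \in enum_fset D' -> (f y <= f z)%E by exists y.
    have : {subset enum_fset D' <= A} by [].
    elim: (enum_fset D') => [|z s IH] sA; first by exists x0.
    have [|y Ay hy] := IH; first by move=> u us; apply: sA; rewrite inE us orbT.
    have Az : A z by apply/set_mem/sA; rewrite inE eqxx.
    have [yz|/ltW zy] := leP (f y) (f z).
      by exists y => // u; rewrite inE => /orP[/eqP ->//|/hy].
    exists z => // u; rewrite inE => /orP[/eqP ->//|/hy]; exact: le_trans.
  by exists y => z /= /hy zy; split.
have [x hx] := cA _ _ _ closedF finF.
by exists x => [|y Ay]; [case: (hx _ Ax0) | case: (hx _ Ay)].
Qed.

(** * Lower and upper bounds on the local utilities *)

Section local_utilities.
Context {R : realType} {m K : nat}.
Variables (Z : set 'rV[R]_m) (c : 'rV[R]_m -> 'rV[R]_m -> R).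
Variables (lk : 'I_K -> 'rV[R]_m -> R) (z : 'rV[R]_m).

(** Staying at [z] costs nothing, so all the weight can go to [k]. The pairs are strictly ordered,
    so a partner [k'] is needed on one side of [k]; it gets weight zero. *)
Lemma local_utility_ge k (b : R) : (1 < K)%N -> Z z -> c z z = 0 -> 0 <= b ->
  ((lk k z)%:E <= local_utility Z c lk z b)%E.
Proof.
move=> K1 Zz cz b0.
have [k' kk'] : exists k' : 'I_K, (k' < k)%N \/ (k < k')%N.
  have [k0|k0] := posnP k.
    by exists (Ordinal K1); right; rewrite k0.
  by exists (Ordinal (ltnW K1)); left.
case: kk' => kk'.
- apply: le_trans (le_bigmax_cond _ (fun k : 'I_K * 'I_K =>
    local_utility_pair Z c lk z k.1 k.2 b) (_ : ((k', k).1 < (k', k).2)%N)) => //.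
  apply: ereal_sup_ubound; exists 0, 1, 0, b, 0, 0.
  by rewrite !addr0 cz !(mulr0, mul0r, mul1r, add0r).
- apply: le_trans (le_bigmax_cond _ (fun k : 'I_K * 'I_K =>
    local_utility_pair Z c lk z k.1 k.2 b) (_ : ((k, k').1 < (k, k').2)%N)) => //.
  apply: ereal_sup_ubound; exists 1, 0, b, 0, 0, 0.
  by rewrite !addr0 cz !(mulr0, mul0r, mul1r, addr0).
Qed.

(** Average the two pointwise bounds with weights [a1], [a2]: the constants are kept since the
    weights sum to one, and the weighted costs are at most the budgets, which sum to [b]. *)
Lemma local_utility_le (w mu kappa b : R) : 0 <= mu ->
  (forall k v, Z (z + v) -> lk k (z + v) <= w + mu * c (z + v) z + kappa) ->
  (local_utility Z c lk z b <= (w + kappa + mu * b)%:E)%E.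
Proof.
move=> mu0 H; apply: bigmax_le => [|[k1 k2] _ /=]; first exact: leNye.
apply: ge_ereal_sup => _ [a1 [a2 [b1 [b2 [v1 [v2 [[a10 a20 b10 b20] [Z1 Z2]
  [c1 c2] [a12 <-] ->]]]]]]]; rewrite lee_fin.
have := ler_wpM2l a10 (H k1 _ Z1); have := ler_wpM2l a20 (H k2 _ Z2).
have := ler_wpM2l mu0 c1; have := ler_wpM2l mu0 c2.
have -> : w + kappa + mu * (b1 + b2) =
  (a1 + a2) * (w + kappa) + mu * (b1 + b2) by rewrite a12 mul1r.
set C1 := c _ _; set C2 := c _ _; set A := lk _ _; set B := lk _ _.
move=> h1 h2 h3 h4.
have E1 : mu * (a1 * C1) = a1 * (mu * C1) by ring.
have E2 : mu * (a2 * C2) = a2 * (mu * C2) by ring.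
lra.
Qed.

End local_utilities.

(** * Bounds and lower semicontinuity of the dual function *)

Section dual.
Context {R : realType} {m K N : nat}.
Variables (Z : set 'rV[R]_m) (c : 'rV[R]_m -> 'rV[R]_m -> R).
Variables (lk : 'I_K -> 'rV[R]_m -> R) (zh : 'I_N -> 'rV[R]_m).
Hypotheses (N0 : (0 < N)%N) (K1 : (1 < K)%N).
Hypotheses (Zzh : forall i, Z (zh i)) (czh : forall i, c (zh i) (zh i) = 0).

Local Notation conjugate i lambda :=
  (ereal_sup [set local_utility Z c lk (zh i) b - (lambda * b)%:E
             | b in [set b : R | (0 <= b)%R]])%E.

Lemma conjugate_ge i k (lambda : R) :
  ((lk k (zh i))%:E <= conjugate i lambda)%E.
Proof.
apply: le_trans (ereal_sup_ubound _); last by exists 0 => //=; exact: lexx.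
by rewrite mulr0 oppr0 adde0; exact: local_utility_ge.
Qed.

Lemma conjugate_gtNy i (lambda : R) : (-oo < conjugate i lambda)%E.
Proof. exact: lt_le_trans (ltNyr _) (conjugate_ge i (Ordinal K1) lambda). Qed.

Lemma dual_function_ge (k : 'I_N -> 'I_K) (rho lambda : R) :
  ((lambda * rho + N%:R^-1 * \sum_i lk (k i) (zh i))%:E <=
   dual_function Z c lk zh rho lambda)%E.
Proof.
rewrite EFinD leeD2l// EFinM lee_pmul2l ?lte_fin ?invr_gt0 ?ltr0n//.
by rewrite -sumEFin; apply: lee_sum => i _; exact: conjugate_ge.
Qed.

Lemma dual_function_le (w : 'I_N -> R) (rho mu kappa : R) : 0 <= mu ->
  (forall i k v, Z (zh i + v) ->
    lk k (zh i + v) <= w i + mu * c (zh i + v) (zh i) + kappa) ->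
  (dual_function Z c lk zh rho mu <=
   (mu * rho + kappa + N%:R^-1 * \sum_i w i)%:E)%E.
Proof.
move=> mu0 H.
have -> : mu * rho + kappa + N%:R^-1 * \sum_i w i =
    mu * rho + N%:R^-1 * \sum_i (w i + kappa).
  rewrite big_split /= sumr_const card_ord -[kappa *+ N]mulr_natl mulrDr mulrA.
  by rewrite mulVf ?pnatr_eq0 -?lt0n// mul1r; ring.
rewrite EFinD leeD2l// EFinM lee_pmul2l ?lte_fin ?invr_gt0 ?ltr0n//.
rewrite -sumEFin; apply: lee_sum => i _; apply: ge_ereal_sup => _ [b _ <-].
by rewrite leeBlDr// -EFinD; apply: local_utility_le => //; exact: H.
Qed.

(** For each [b] the inner term is affine in the multiplier or constantly [+oo], so its supremum
    over [b] is lower semicontinuous; never being [-oo], the suprema may be summed. *)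
Lemma dual_function_lsc (rho : R) :
  lower_semicontinuous (dual_function Z c lk zh rho).
Proof.
apply: lower_semicontinuousD => [lambda|lambda||]; first exact: ltNyr.
- apply: (lt_le_trans
    (ltNyr (N%:R^-1 * \sum_(i < N) lk (Ordinal K1) (zh i)))).
  rewrite EFinM lee_pmul2l ?lte_fin ?invr_gt0 ?ltr0n//.
  by rewrite -sumEFin; apply: lee_sum => i _; exact: conjugate_ge.
- by apply: lower_semicontinuous_EFin => x; apply: mulrr_continuous.
apply: lower_semicontinuousZ; first by rewrite invr_gt0 ltr0n.
apply: lower_semicontinuous_sum => [i lambda|i]; first exact: conjugate_gtNy.
apply: (@lower_semicontinuous_sup _ _ _ _ (fun b lambda => _)) => b b0.
have := local_utility_ge lk (Ordinal K1) K1 (Zzh i) (czh i) b0.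
case: local_utility => [v _|_|//].
  apply: lower_semicontinuous_EFin => x.
  apply: (@cvgB _ _ _ (nbhs x)); first exact: cvg_cst.
  exact: mulrr_continuous.
by move=> x a _; exists setT => [|y _]; [exact: filterT | rewrite ltry].
Qed.

End dual.

(** * Confining a minimizer of the dual function to the interval *)

Theorem lemma13 (R : realType) (n m K N : nat)
    (X : set 'rV[R]_n) (Z : set 'rV[R]_m)
    (c : 'rV[R]_m -> 'rV[R]_m -> R) (zh : 'I_N -> 'rV[R]_m) (rho : R)
    (l : 'I_K -> 'rV[R]_n -> 'rV[R]_m -> R)
    (nrm : 'rV[R]_m -> R) (p : R) (x : 'rV[R]_n)
    (hN : (0 < N)%N)
    (hc : transportation_cost Z c)
    (hzh : forall i, Z (zh i))
    (hrho : 0 < rho)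
    (hreg : regularity X Z c zh rho l nrm p)
    (hx : X x)
    (horacle : local_oracle Z c (fun k => l k x)) :
  exists lambda : R,
    optimal_dual_multiplier Z c (fun k => l k x) zh rho lambda /\
    0 <= lambda <= multiplier_bound nrm p (fun k => l k x) zh rho.
Proof.
case: hreg => _ _ _ _ _ _ K1 _ lconc hnrm p1 cnrm _.
have p0 : 0 < p by lra.
set lk := fun k => l k x; set D := dual_function Z c lk zh rho.
have czh i : c (zh i) (zh i) = 0 by rewrite (cost_refl hc).
have DN lambda : (-oo < D lambda)%E.
  exact: lt_le_trans (ltNyr _)
    (dual_function_ge lk hN K1 hzh czh (fun=> Ordinal K1) _ _).
pose G := \big[Num.max/0]_(i < N) local_lipschitz nrm lk (zh i).
pose U := rho `^ ((1 - p) / p) * G.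
rewrite (_ : multiplier_bound _ _ _ _ _ = U)//.
have G0 : 0 <= G by exact: bigmax_ge_id.
have U0 : 0 <= U by rewrite mulr_ge0// powR_ge0.
have lip i k v : lk k (zh i + v) <= lk k (zh i) + G * nrm v.
  apply: le_trans (concave_lipschitz _ _ hnrm (lconc k x)) _.
  rewrite lerD2l ler_wpM2r ?nrm_ge0//.
  apply: le_trans (le_bigmax _ (fun i => local_lipschitz nrm lk (zh i)) i).
  exact: (le_bigmax _ (fun k => sup [set dual_norm nrm xi
    | xi in superdifferential (lk k) (zh i)]) k).
(* Picking a maximal piece at each [zh i] makes the constants in the upper and lower bounds on [D]
   coincide. *)
have [k kmax] : exists k : 'I_N -> 'I_K,
    forall i k', lk k' (zh i) <= lk (k i) (zh i).
  exists (fun i => [arg max_(k > Ordinal K1) lk k (zh i)]%O) => i k'.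
  by case: arg_maxP => // k0 _; exact.
(* Slope and constant term of [U] times the tangent line; they satisfy
   [mu * rho + kappa = U * rho]. *)
pose mu := U / p; pose kappa := U * ((1 - p^-1) * rho).
have mu0 : 0 <= mu by rewrite divr_ge0// ltW.
have growth i k' v : Z (zh i + v) -> lk k' (zh i + v) <=
    lk (k i) (zh i) + mu * c (zh i + v) (zh i) + kappa.
  move=> Zv; apply: le_trans (lip _ _ _) _; rewrite -addrA lerD//.
  have h : nrm v `^ p <= c (zh i + v) (zh i).
    by have := cnrm _ _ Zv (hzh i); rewrite [zh i + v]addrC addrK.
  apply: le_trans (ler_wpM2l G0 (powR_tangent p1 hrho (nrm_ge0 hnrm v))) _.
  rewrite mulrA [G * _]mulrC -/U mulrDr lerD2r /mu -mulrA ler_wpM2l//.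
  by rewrite ler_wpM2l// invr_ge0 ltW.
have D_large lambda : U <= lambda -> (D mu <= D lambda)%E.
  move=> Ul; apply: le_trans (dual_function_le hN rho mu0 growth) _.
  apply: le_trans (dual_function_ge lk hN K1 hzh czh k _ _).
  rewrite lee_fin lerD2r (_ : mu * rho + kappa = U * rho); last first.
    by rewrite /mu /kappa; ring.
  by rewrite ler_wpM2r// ltW.
have muU : mu <= U by rewrite /mu ler_pdivrMr// ler_peMr.
have [|lambda] := compact_lower_semicontinuous_min
  (@segment_compact R 0 U) _ DN (dual_function_lsc hN K1 hzh czh (rho := rho)).
  by exists 0; rewrite /= in_itv /= lexx.
rewrite /= in_itv /= => lambda_itv lambda_min; exists lambda; split => //.
split=> [|nu nu0]; first by case/andP: lambda_itv.
(* Beyond [U] the comparison passes through [mu], which lies in the interval because [p] is at least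
   one. *)
have [nuU|/ltW Unu] := leP nu U.
  by apply: lambda_min; rewrite /= in_itv /= nu0.
apply: le_trans (D_large _ Unu); apply: lambda_min.
by rewrite /= in_itv /= mu0.
Qed.
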